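(* Let $G$ be a finitely generated discrete group, let $(X,d)$ be a compact metric space, and let $T\in Act(G,X)$ be a continuous action of $G$ on $X$ which is expansive and has the pseudo-orbit tracing property (POTP). Then $T$ is topologically stable. Moreover, let $\eta$ be an expansive constant of $T$. For every finite generating set $A$ of $G$ and every $\varepsilon>0$ with $\varepsilon<\eta$, there exists $\delta>0$ such that for every continuous action $S\in Act(G,X)$ with $d_A(T,S)<\delta$ there is a unique map $f:X\to X$ with $T_gf=fS_g$ for every $g\in G$ and $d(f,\mathrm{Id}_X)\le\varepsilon$. Furthermore, if $S$ is also expansive with an expansive constant $\eta_S\ge 2\varepsilon$, then this conjugating map $f$ is injective.
   Context: $G$ is a finitely generated discrete group and $(X,d)$ a compact metric space. $Act(G,X)$ is the set of all continuous actions of $G$ on $X$ (homomorphisms $g\mapsto T_g$ from $G$ to the homeomorphism group of $X$). A finite generating set $A$ of $G$ is a finite set generating $G$ as a group; it is symmetric if $a\in A$ implies $a^{-1}\in A$. For a finite generating set $A$ and $T,S\in Act(G,X)$, put $d_A(T,S)=\sup_{x\in X,\,a\in A}d(T_ax,S_ax)$. For $f:X\to X$, put $d(f,\mathrm{Id}_X)=\sup_{x\in X}d(f(x),x)$. $T$ is $A$-topologically stable if for every $\varepsilon>0$ there is $\delta>0$ such that for every $S\in Act(G,X)$ with $d_A(T,S)<\delta$ there is a continuous map $f:X\to X$ with $T_gf=fS_g$ for all $g\in G$ and $d(f,\mathrm{Id}_X)\le\varepsilon$. $T$ is topologically stable if it is $A$-topologically stable for a symmetric finite generating set $A$ of $G$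 (this does not depend on the choice of symmetric $A$). For $\delta>0$, a $\delta$ pseudo-orbit of $T$ with respect to $A$ is a family $\{x_g\}_{g\in G}$ in $X$ with $d(T_ax_g,x_{ag})<\delta$ for all $a\in A$, $g\in G$. $T$ has POTP with respect to $A$ if for every $\varepsilon>0$ there is $\delta>0$ such that every $\delta$ pseudo-orbit $\{x_g\}_{g\in G}$ of $T$ with respect to $A$ is $\varepsilon$-traced by some $x\in X$, i.e. $d(T_gx,x_g)<\varepsilon$ for all $g\in G$. $T$ has POTP if it has POTP with respect to a finite generating set $A$ of $G$ (this does not depend on the choice of $A$). $T$ is expansive if there is a constant $c>0$, called an expansive constant of $T$, such that $\sup_{g\in G}d(T_gx,T_gy)>c$ for all $x\ne y$ in $X$. *)

(* Defs.v *)
From HB Require Import structures.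
From mathcomp Require Import all_boot all_order all_algebra finmap.
From mathcomp Require Import all_classical all_reals all_analysis.
Set Implicit Arguments.
Unset Strict Implicit.
Unset Printing Implicit Defensive.
Import Order.TTheory GRing.Theory Num.Theory.
Local Open Scope classical_set_scope.
Local Open Scope ring_scope.

Section Generation.
Variable G : groupType.

(* The smallest subgroup of G containing A is G itself. *)
Definition generates (A : {fset G}) : Prop :=
  forall H : {pred G}, group_closed H -> {subset A <= H} -> forall g, g \in H.

Definition finitely_generated : Prop := exists A : {fset G}, generates A.

Definition symmetric_fset (A : {fset G}) : Prop :=
  forall a, a \in A -> (a^-1)%g \in A.

End Generation.

Definition homeomorphism (X : topologicalType) (f : X -> X) : Prop :=
  continuous f /\
  exists f' : X -> X, [/\ continuous f', cancel f f' & cancel f' f].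

(* A homomorphism from G to the homeomorphism group of X; that 1 acts as the
   identity is a consequence, as for any homomorphism of groups. *)
Record continuous_action (G : groupType) (X : topologicalType) :=
  ContinuousAction {
    act :> G -> X -> X;
    act_homeomorphism : forall g, homeomorphism (act g);
    actM : forall g h, act (g * h)%g = act g \o act h }.

(* The suprema below are real-valued: they are the intended ones when the set
   is nonempty and bounded, which compactness of X guarantees as soon as X and
   A are nonempty; sup set0 = 0 is the right value for a supremum of distances
   over an empty index set. *)
Section Dynamics.
Variables (R : realType) (G : groupType) (X : metricType R).
Implicit Types (T S : continuous_action G X) (A : {fset G}).

Definition dist_act A T S : R :=
  sup [set r | exists x a, a \in A /\ r = mdist (T a x) (S a x)].

Definition dist_id (f : X -> X) : R :=
  sup [set mdist (f x) x | x in [set: X]].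

Definition semiconjugates T S (f : X -> X) : Prop :=
  forall g, T g \o f = f \o S g.

Definition topologically_stable_wrt A T : Prop :=
  forall eps : R, 0 < eps -> exists delta : R, 0 < delta /\
    forall S, dist_act A T S < delta ->
      exists f : X -> X,
        [/\ continuous f, semiconjugates T S f & dist_id f <= eps].

Definition topologically_stable T : Prop :=
  exists A, [/\ generates A, symmetric_fset A & topologically_stable_wrt A T].

Definition pseudo_orbit A T (delta : R) (x : G -> X) : Prop :=
  forall a g, a \in A -> mdist (T a (x g)) (x (a * g)%g) < delta.

Definition traced T (eps : R) (x : G -> X) (y : X) : Prop :=
  forall g, mdist (T g y) (x g) < eps.

Definition POTP_wrt A T : Prop :=
  forall eps : R, 0 < eps -> exists delta : R, 0 < delta /\
    forall x : G -> X, pseudo_orbit A T delta x -> exists y, traced T eps x y.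

Definition POTP T : Prop := exists A, generates A /\ POTP_wrt A T.

Definition expansive_constant T (c : R) : Prop :=
  0 < c /\ forall x y : X, x <> y ->
    c < sup [set mdist (T g x) (T g y) | g in [set: G]].

Definition expansive T : Prop := exists c : R, expansive_constant T c.

End Dynamics.

(* Main.v *)
Require Import Defs.
From HB Require Import structures.
From mathcomp Require Import all_boot all_order all_algebra finmap.
From mathcomp Require Import all_classical all_reals all_analysis.
Set Implicit Arguments.
Unset Strict Implicit.
Unset Printing Implicit Defensive.
Import Order.TTheory GRing.Theory Num.Theory.
Local Open Scope classical_set_scope.
Local Open Scope ring_scope.

(** An action [S] uniformly close to [T] on generators has orbits that are
    pseudo-orbits of [T]: [S_(a g) x = S_a (S_g x)] is close to [T_a (S_g x)].
    The tracing property provides a point [f x] whose [T]-orbit [e]-traces the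
    [S]-orbit of [x].  When [2 e] is at most an expansive constant of [T], such
    a point is unique, and everything follows from this uniqueness.

    Equivariance ([traced_semiconjugates]): [T_h (f x)] traces the orbit of
    [S_h x], as [f (S_h x)] does.  Continuity ([traced_continuous]): being an
    [e]-tracing point, up to non-strict inequality, is a closed condition on
    the pair (base point, tracing point), so [f] has a closed graph in a
    compact space.

    The tracing property may be known for one generating set while [S] is only
    controlled on another.  The group elements at which closeness on [A] forces
    closeness form a subgroup containing [A] ([dist_act_generates]), hence all
    of [G]; uniform continuity of each [T_g], by compactness, gives closure
    under the group operations.

    Uniqueness of the conjugating map is claimed among all maps at distance at
    most [eps] from the identity, for any [eps < eta].  Comparing two such maps
    with each other would require [2 eps <= eta].  Instead, [delta] is chosen so
    small that [f] is within [e = min (eps, eta - eps, eta / 2)] of the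
    identity; along orbits, any competitor then stays within [e + eps <= eta]
    of [f], and expansivity of [T] makes it equal to [f]
    ([semiconjugacy_unique]).  If [f x = f y], the [S]-orbits of [x] and [y]
    both stay within [eps] of the same points, so expansivity of [S] gives
    [x = y] ([semiconjugacy_injective]). *)

(** * Group actions by homeomorphisms *)

(** [T_1] is an idempotent bijection. *)
Lemma act1 (G : groupType) (X : topologicalType) (T : continuous_action G X)
    (x : X) : T 1%g x = x.
Proof.
have [_ [T' [_ T'K _]]] := act_homeomorphism T 1%g.
by apply: (can_inj T'K); rewrite -[LHS]/((T 1%g \o T 1%g) x) -actM mul1g.
Qed.

Lemma actVK (G : groupType) (X : topologicalType) (T : continuous_action G X)
    (g : G) : cancel (T g) (T g^-1%g).
Proof. by move=> x; rewrite -[LHS]/((_ \o _) x) -actM mulVg act1. Qed.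

Lemma continuous_act (G : groupType) (X : topologicalType)
  (T : continuous_action G X) (g : G) : continuous (T g).
Proof. by have [] := act_homeomorphism T g. Qed.

(** * Compact metric spaces *)

Lemma continuous_near_mdist (R : realType) (X : topologicalType)
    (Y : metricType R) (f : X -> Y) (x : X) (e : R) :
  {for x, continuous f} -> 0 < e -> \forall y \near x, mdist (f x) (f y) < e.
Proof.
by move=> fx; move: e; exact/metricType_numDomainType.cvgrPdist_lt.
Qed.

Lemma near_mdist_lt (R : realType) (X : metricType R) (x : X) (e : R) :
  0 < e -> \forall y \near x, mdist x y < e.
Proof. exact/(@continuous_near_mdist _ _ _ id)/cvg_id. Qed.

Section Compactness.
Context {R : realType} {X : metricType R}.
Hypothesis cptX : compact [set: X].

(** Heine-Cantor, as an instance of near-covering compactness along the filter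
    of small positive radii. *)
Lemma compact_uniformly_continuous (Y : metricType R) (f : X -> Y) (e : R) :
  continuous f -> 0 < e -> exists2 d, 0 < d &
    forall x y, mdist x y < d -> mdist (f x) (f y) < e.
Proof.
move=> fc e0.
pose P d x := forall y, mdist x y < d -> mdist (f x) (f y) < e.
have [|d /= d0 dP] :=
    (compact_near_coveringP _).1 cptX _ (0^'+ : set_system R) P.
  move=> x _; have e20 : 0 < e / 2 by rewrite divr_gt0.
  have /metricType_numDomainType.nbhs_mdistP[d /= d0 fd] :=
    continuous_near_mdist (fc x) e20.
  have d20 : 0 < d / 2 by rewrite divr_gt0.
  exists ([set x' | mdist x x' < d / 2], [set r | r < d / 2]) => /=.
    by split; [exact: near_mdist_lt|exact: nbhs_right_lt].
  move=> [x' r] /= [xx' rd] y x'y.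
  apply: (le_lt_trans (metric_triangle _ (f x) _)).
  rewrite (splitr e) ltrD//.
    rewrite metric_sym fd//= (lt_trans xx')//.
    by rewrite gtr_pMr// invf_lt1// ltr1n.
  apply: fd => /=; apply: (le_lt_trans (metric_triangle _ x' _)).
  by rewrite (splitr d) ltrD// (lt_trans x'y).
have d20 : 0 < d / 2 by rewrite divr_gt0.
exists (d / 2) => // x y xy; apply: (dP (d / 2)) => //=.
by rewrite sub0r normrN gtr0_norm// gtr_pMr// invf_lt1// ltr1n.
Qed.

(** Makes the real-valued suprema of distances on [X] genuine upper bounds. *)
Lemma compact_mdist_bounded : exists M : R, forall x y : X, mdist x y <= M.
Proof.
have [[x0 _]|noX] := pselect (exists _ : X, True); last first.
  by exists 0 => x; exfalso; apply: noX; exists x.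
have [|M [_ MP]] := (compact_near_coveringP _).1 cptX _ (+oo : set_system R)
    (fun M x => mdist x0 x <= M).
  move=> x _; exists ([set x' | mdist x x' < 1], [set M | mdist x0 x + 1 < M]).
    split => /=; first exact: near_mdist_lt.
    by exists (mdist x0 x + 1); split=> //; exact: num_real.
  move=> [x' M] /= [xx' /ltW]; apply: le_trans.
  by apply: (le_trans (metric_triangle _ x _)); rewrite lerD2l ltW.
exists ((M + 1) + (M + 1)) => x y.
apply: (le_trans (metric_triangle _ x0 _)).
have leM z : mdist x0 z <= M + 1 by apply: MP => //; rewrite ltrDl.
by rewrite lerD// metric_sym.
Qed.

(** The closed graph theorem for maps to a compact space: by compactness
    [f @ x] has a cluster point, and it converges once that point is unique. *)
Lemma compact_cluster_continuous (Y : topologicalType) (f : Y -> X) :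
  (forall x, cluster (f @ x) `<=` [set f x]) -> continuous f.
Proof.
move=> clf x; apply: (@compact_cluster_set1 _ _ _ [set: X]) => //.
- exact: metric_hausdorff.
- exact: filterT.
- exact: filterT.
- apply/seteqP; split => [|_ ->]; first exact: clf.
  have [y [_ cly]] :=
    cptX (fmap_proper_filter f (nbhs_pfilter x)) filterT.
  by rewrite -(clf x y cly).
Qed.

End Compactness.

(** * Distances between actions and expansivity *)

Section Dynamics.
Context {R : realType} {G : groupType} {X : metricType R}.
Hypothesis cptX : compact [set: X].
Implicit Types (T S : continuous_action G X) (A B : {fset G}) (f : X -> X).

Lemma mdist_le_dist_act A T S a x :
  a \in A -> mdist (T a x) (S a x) <= dist_act A T S.
Proof.
move=> aA; have [M XM] := compact_mdist_bounded cptX.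
apply: ub_le_sup; last by exists x, a.
by exists M => _ [y [b [_ ->]]].
Qed.

Lemma dist_id_leP f (e : R) : 0 < e ->
  dist_id f <= e <-> forall x, mdist (f x) x <= e.
Proof.
move=> e0; split=> [fe x|fe].
  have [M XM] := compact_mdist_bounded cptX.
  apply: le_trans fe; apply: ub_le_sup; last by exists x.
  by exists M => _ [y _ <-].
(* If X is empty, the supremum is 0 by convention. *)
rewrite /dist_id.
have [->|/set0P ne] := eqVneq [set mdist (f x) x | x in [set: X]] set0.
  by rewrite sup0 ltW.
by apply: ge_sup => // _ [x _ <-].
Qed.

Lemma expansive_constant_eq T (c : R) x y : expansive_constant T c ->
  (forall g, mdist (T g x) (T g y) <= c) -> x = y.
Proof.
move=> [_ Tc] le_c; apply: contrapT => /Tc; apply/negP; rewrite -leNgt.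
apply: ge_sup => [|_ [g _ <-] //].
by exists (mdist (T 1%g x) (T 1%g y)); exists 1%g.
Qed.

(** * Closeness on generators and tracing of orbits *)

(** The set of [g] with this property is a subgroup containing [A].  For
    inverses, [x = S_g y] with [y = S_(g^-1) x], and [T_(g^-1)] carries the
    nearby points [S_g y] and [T_g y] to nearby points, the second of which is
    [y].  For products, [T_g (T_h x)] is compared with [S_g (S_h x)] through
    [T_g (S_h x)]. *)
Lemma dist_act_generates A T g (e : R) : generates A -> 0 < e ->
  exists2 d, 0 < d & forall S, dist_act A T S < d ->
    forall x, mdist (T g x) (S g x) < e.
Proof.
move=> genA; move: g e.
pose P g := forall e : R, 0 < e -> exists2 d, 0 < d & forall S,
  dist_act A T S < d -> forall x, mdist (T g x) (S g x) < e.
suff PG : forall g, P g by move=> g e; exact: PG.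
have PV g : P g -> P g^-1%g.
  move=> Pg e e0.
  have [d1 d10 Td1] :=
    compact_uniformly_continuous cptX (@continuous_act _ _ T g^-1%g) e0.
  have [d d0 Sd] := Pg _ d10; exists d => // S /Sd {}Sd x.
  have SK : S g (S g^-1%g x) = x by have := actVK S g^-1%g x; rewrite invgK.
  rewrite -[X in mdist (T _ X) _]SK -[X in mdist _ X](actVK T g) Td1//.
  by rewrite metric_sym.
have PM g h : P g -> P h -> P (g * h)%g.
  move=> Pg Ph e e0; have e20 : 0 < e / 2 by rewrite divr_gt0.
  have [d1 d10 Td1] :=
    compact_uniformly_continuous cptX (@continuous_act _ _ T g) e20.
  have [d2 d20 Sd2] := Pg _ e20; have [d3 d30 Sd3] := Ph _ d10.
  exists (Num.min d2 d3); first by rewrite lt_min d20.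
  move=> S; rewrite lt_min => /andP[/Sd2 {}Sd2 /Sd3 {}Sd3] x.
  rewrite !actM /=; apply: (le_lt_trans (metric_triangle _ (T g (S h x)) _)).
  by rewrite (splitr e) ltrD// Td1.
move=> g; suff : g \in [pred g | `[< P g >]] by move/asboolP.
apply: genA => [|a aA].
  split=> [|g1 g2].
    apply/asboolP => e e0; exists 1 => // S _ x.
    by rewrite !act1 mdistxx.
  by move=> /asboolP Pg1 /asboolP Pg2; apply/asboolP; apply/PM/PV.
apply/asboolP => e e0; exists e => // S Se x.
exact: le_lt_trans (mdist_le_dist_act T S x aA) Se.
Qed.

Lemma dist_act_generates_fset A B T (e : R) : generates A -> 0 < e ->
  exists2 d, 0 < d & forall S, dist_act A T S < d ->
    forall b x, b \in B -> mdist (T b x) (S b x) < e.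
Proof.
move=> genA e0.
suff [d d0 Sd] : exists2 d, 0 < d & forall S, dist_act A T S < d ->
    forall b x, b \in enum_fset B -> mdist (T b x) (S b x) < e by exists d.
elim: (enum_fset B) => [|b s [d1 d10 Sd1]]; first by exists 1.
have [d2 d20 Sd2] := dist_act_generates T b genA e0.
exists (Num.min d1 d2); first by rewrite lt_min d10.
move=> S; rewrite lt_min => /andP[/Sd1 {}Sd1 /Sd2 {}Sd2] b' x.
by rewrite in_cons => /orP[/eqP ->|/Sd1].
Qed.

(** The tracing property may come with another generating set than [A];
    closeness on its finitely many elements is what makes the [S]-orbits
    pseudo-orbits of [T]. *)
Lemma POTP_orbits_traced A T (e : R) : generates A -> POTP T -> 0 < e ->
  exists2 d, 0 < d & forall S, dist_act A T S < d ->
    forall x, exists y, traced T e (S^~ x) y.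
Proof.
move=> genA [B [_ potpB]] /potpB[d0 [d00 tr]].
have [d dgt0 Sd] := dist_act_generates_fset B T genA d00.
exists d => // S /Sd {}Sd x; apply: tr => b g bB.
by rewrite actM Sd.
Qed.

(** * The semiconjugacy defined by tracing *)

(** The non-strict inequalities, weaker than those of [traced], are what passes
    to the limit in the proof of continuity. *)
Lemma traced_eq T (c e : R) (x : G -> X) y y' :
  expansive_constant T c -> 2 * e <= c ->
  (forall g, mdist (T g y) (x g) <= e) ->
  (forall g, mdist (T g y') (x g) <= e) -> y = y'.
Proof.
move=> Tc ec ye y'e; apply: (expansive_constant_eq Tc) => g.
apply: (le_trans (metric_triangle _ (x g) _)).
by rewrite (le_trans _ ec)// mulr_natl mulr2n lerD// metric_sym.
Qed.

Section Tracing.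
Context {T S : continuous_action G X} {c e : R} {f : X -> X}.
Hypothesis Tc : expansive_constant T c.
Hypothesis ec : 2 * e <= c.
Hypothesis trf : forall x, traced T e (S^~ x) (f x).

(** [T_h (f x)] traces the [S]-orbit of [S_h x], because [S_g (S_h x)] is
    [S_(g h) x]. *)
Lemma traced_semiconjugates : semiconjugates T S f.
Proof.
move=> h; apply/funext => x /=.
apply: (traced_eq (x := S^~ (S h x)) Tc ec) => g; apply: ltW; last exact: trf.
rewrite -[T g _]/((T g \o T h) _) -[S g _]/((S g \o S h) _) -!actM.
exact: trf.
Qed.

(** A cluster point [y] of [f] at [x] satisfies the tracing inequalities at [x]:
    for each [g] separately, [T_g (f x')] and [S_g x'] are within [e], and some
    [x'] has [S_g x'] near [S_g x] and [T_g (f x')] near [T_g y]. *)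
Lemma traced_continuous : continuous f.
Proof.
apply: (compact_cluster_continuous cptX) => x y cly /=.
apply: (traced_eq (x := S^~ x) Tc ec) => g; last exact/ltW/trf.
apply/ler_addgt0Pr => r r0; have r20 : 0 < r / 2 by rewrite divr_gt0.
have /= Tgy := continuous_near_mdist (@continuous_act _ _ T g y) r20.
have /= Sgx := continuous_near_mdist (@continuous_act _ _ S g x) r20.
have [|_ [[x' Sgx' <-] Tgfx']] :=
  cly [set f x' | x' in [set x' | mdist (S g x) (S g x') < r / 2]] _ _ Tgy.
  by apply: filterS Sgx => x' Sgx'; exists x'.
apply: (le_trans (metric_triangle _ (T g (f x')) _)).
have -> : e + r = r / 2 + (e + r / 2) by rewrite addrCA -splitr.
rewrite lerD//; first exact: ltW.
apply: (le_trans (metric_triangle _ (S g x') _)).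
by rewrite lerD//; [exact/ltW/trf|rewrite metric_sym ltW].
Qed.

End Tracing.

Lemma POTP_semiconjugacy A T (c e : R) : generates A -> POTP T ->
  expansive_constant T c -> 0 < e -> 2 * e <= c ->
  exists2 d, 0 < d & forall S, dist_act A T S < d ->
    exists f, [/\ continuous f, semiconjugates T S f & dist_id f <= e].
Proof.
move=> genA potp Tc e0 ec.
have [d d0 Sd] := POTP_orbits_traced genA potp e0.
exists d => // S /Sd/choice[f trf]; exists f; split.
- exact: (traced_continuous Tc ec trf).
- exact: (traced_semiconjugates Tc ec trf).
- apply/(dist_id_leP _ e0) => x.
  by have := trf x 1%g; rewrite !act1 => /ltW.
Qed.

(** * Uniqueness and injectivity of semiconjugacies near the identity *)

(** [T_g (f x) = f (S_g x)] is within [e], and [T_g (f' x) = f' (S_g x)] within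
    [e'], of the same point [S_g x].  The two bounds are kept apart because only
    their sum has to respect the expansive constant. *)
Lemma semiconjugacy_unique T S (c e e' : R) f f' :
  expansive_constant T c -> e + e' <= c ->
  semiconjugates T S f -> (forall x, mdist (f x) x <= e) ->
  semiconjugates T S f' -> (forall x, mdist (f' x) x <= e') -> f = f'.
Proof.
move=> Tc ec Tf fe Tf' f'e; apply/funext => x.
apply: (expansive_constant_eq Tc) => g.
rewrite -[T g (f x)]/((T g \o f) x) -[T g (f' x)]/((T g \o f') x) Tf Tf' /=.
apply: (le_trans (metric_triangle _ (S g x) _)).
by rewrite (le_trans _ ec)// lerD// metric_sym.
Qed.

(** [f x = f y] forces [f (S_g x) = f (S_g y)], a point within [e] of both
    [S_g x] and [S_g y]. *)
Lemma semiconjugacy_injective T S (c e : R) f :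
  expansive_constant S c -> 2 * e <= c ->
  semiconjugates T S f -> (forall x, mdist (f x) x <= e) -> injective f.
Proof.
move=> Sc ec Tf fe x y fxy; apply: (expansive_constant_eq Sc) => g.
have fS : f (S g x) = f (S g y).
  by rewrite -[LHS]/((f \o _) x) -[RHS]/((f \o _) y) -Tf /= fxy.
apply: (le_trans (metric_triangle _ (f (S g x)) _)).
rewrite (le_trans _ ec)// mulr_natl mulr2n lerD//; first by rewrite metric_sym.
by rewrite fS.
Qed.

Lemma generates_symmetric A : generates A ->
  exists2 B : {fset G}, generates B & symmetric_fset B.
Proof.
move=> genA; exists (A `|` [fset (a^-1)%g | a in A])%fset.
  move=> H Hcl BH; apply: genA => // a aA.
  by apply: BH; rewrite inE aA.
move=> b; rewrite !inE => /orP[bA|/imfsetP[a /= aA ->]].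
  by apply/orP; right; apply/imfsetP; exists b.
by rewrite invgK aA.
Qed.

End Dynamics.

(** * The stability theorem *)

Unset Implicit Arguments.

Theorem theorem2p8 (R : realType) (G : groupType) (X : metricType R)
    (T : continuous_action G X) :
  finitely_generated G -> compact [set: X] -> expansive T -> POTP T ->
  topologically_stable T /\
  (forall eta : R, expansive_constant T eta ->
   forall A : {fset G}, generates A ->
   forall eps : R, 0 < eps -> eps < eta ->
   exists delta : R, 0 < delta /\
     forall S : continuous_action G X, dist_act A T S < delta ->
     exists f : X -> X,
       unique (fun f => semiconjugates T S f /\ dist_id f <= eps) f /\
       (forall etaS : R, expansive_constant S etaS -> 2 * eps <= etaS ->
        injective f)).
Proof.
move=> [A0 genA0] cptX [c Tc] potp; split.
  have [A genA symA] := generates_symmetric genA0.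
  exists A; split=> // eps eps0; have c0 := Tc.1.
  pose e := Num.min eps (c / 2).
  have e0 : 0 < e by rewrite lt_min eps0 divr_gt0.
  have ec : 2 * e <= c by rewrite mulrC -ler_pdivlMr// ge_min lexx orbT.
  have [d d0 Sd] := POTP_semiconjugacy cptX genA potp Tc e0 ec.
  exists d; split=> // S /Sd[f [fc Tf fe]]; exists f; split=> //.
  by rewrite (le_trans fe)// ge_min lexx.
move=> eta Teta A genA eps eps0 eps_eta; have eta0 := Teta.1.
(* eta / 2 makes tracing points unique; eta - eps leaves room for a competitor
   that is only eps-close to the identity. *)
pose e := Num.min (Num.min eps (eta - eps)) (eta / 2).
have e0 : 0 < e by rewrite !lt_min eps0 subr_gt0 eps_eta divr_gt0.
have e_eps : e <= eps by rewrite !ge_min lexx.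
have e_sub : e + eps <= eta by rewrite -lerBrDr !ge_min lexx orbT.
have e_half : 2 * e <= eta by rewrite mulrC -ler_pdivlMr// ge_min lexx orbT.
have [d d0 Sd] := POTP_semiconjugacy cptX genA potp Teta e0 e_half.
exists d; split=> // S /Sd[f [_ Tf fe]]; exists f.
have f_eps : dist_id f <= eps by exact: le_trans fe e_eps.
split; first (split=> // f' [Tf' f'eps]).
  apply: (semiconjugacy_unique Teta e_sub) => //.
  - exact/dist_id_leP.
  - exact/dist_id_leP.
move=> etaS SetaS eps_etaS.
apply: (semiconjugacy_injective SetaS eps_etaS) => //.
exact/dist_id_leP.
Qed.
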